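(* Let $n\ge 6$. Among all cycle barbells $CB(k,a,b)$ (with integers $a,b\ge3$, $k\ge2$) having exactly $n$ vertices, the edge Kemeny's constant $\mathscr{K}_e$ is maximized by $CB(n-4,3,3)$, i.e. when $a=b=3$ and the path contains all remaining vertices. Moreover, \[ \mathscr{K}_e(CB(n-4,3,3))=\frac{2n^3+12n^2-51n+101}{6(n+1)}. \]
   Context: The cycle barbell $CB(k,a,b)$ is the graph obtained from a cycle $C_a$, a path $P_k$ on $k$ vertices and a cycle $C_b$ by identifying one endpoint of the path with a vertex of $C_a$ and the other endpoint with a vertex of $C_b$. It has $a+b+k-2$ vertices and $a+b+k-1$ edges. Kemeny's constant of an irreducible finite Markov chain with transition matrix $P$ whose eigenvalues (with multiplicity) are $1=\rho_1,\rho_2,\dots,\rho_N$ (with $1$ simple) is $\mathscr{K}(P)=\sum_{i=2}^{N}\frac{1}{1-\rho_i}$. $\mathscr{K}_e(G)$ is Kemeny's constant of the simple random walk on the arcs of $G$ (ordered pairs $(u,v)$ with $\{u,v\}$ an edge), where from $(u,v)$ one moves to $(v,w)$ with probability $1/\deg(v)$ for each neighbor $w$ of $v$. *)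

(* Defs.v *)
From HB Require Import structures.
From mathcomp Require Import all_boot all_order all_algebra algC.
Unset Printing Implicit Defensive.
Import Order.TTheory GRing.Theory Num.Theory.
Local Open Scope ring_scope.

(* Vertex labelling of CB(k,a,b), N = a+b+k-2 vertices 0..N-1:
   cycle C_a on 0..a-1 (closing edge {0,a-1});
   path P_k on a-1, a, ..., a+k-2;
   cycle C_b on a+k-2, ..., a+b+k-3 (closing edge {a+k-2, a+b+k-3}).
   All consecutive pairs {i,i+1} (i+1 < N) are edges. *)
Definition cb_n (k a b : nat) : nat := (a + b + k - 2)%N.

Definition cb_edge0 (k a b : nat) (u v : nat) : bool :=
  [|| (u.+1 == v) && (v < cb_n k a b)%N,
      (u == 0%N) && (v == a.-1) |
      (u == (a + k - 2)%N) && (v == (a + b + k - 3)%N)].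

Definition cb_adj (k a b : nat) : rel 'I_(cb_n k a b) :=
  fun u v => cb_edge0 k a b u v || cb_edge0 k a b v u.

Definition cb_arc (k a b : nat) :=
  {x : 'I_(cb_n k a b) * 'I_(cb_n k a b) | cb_adj k a b x.1 x.2}.

Definition cb_deg (k a b : nat) (v : 'I_(cb_n k a b)) : nat :=
  #|[set w | cb_adj k a b v w]|.

(* Transition probability of the simple random walk on arcs (backtracking allowed):
   (u,v) -> (v,w) with probability 1/deg v, for each neighbour w of v. *)
Definition cb_arc_trans (k a b : nat) (x y : cb_arc k a b) : algC :=
  if (val x).2 == (val y).1 then ((cb_deg k a b (val x).2)%:R)^-1 else 0.

Definition cb_arc_mx (k a b : nat) : 'M[algC]_(#|{: cb_arc k a b}|) :=
  \matrix_(i, j) cb_arc_trans k a b (enum_val i) (enum_val j).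

Definition eigs (m : nat) (P : 'M[algC]_m) : seq algC :=
  sval (closed_field_poly_normal (char_poly P)).

Definition kemeny (m : nat) (P : 'M[algC]_m) : algC :=
  \sum_(z <- rem 1 (eigs m P)) (1 - z)^-1.

Definition Ke_CB (k a b : nat) : algC := kemeny _ (cb_arc_mx k a b).

(* Main.v *)
Require Import Defs.
From HB Require Import structures.
From mathcomp Require Import all_boot all_order all_algebra algC.
From mathcomp Require Import ring zify.
Import Order.TTheory GRing.Theory Num.Theory.
Local Open Scope ring_scope.

(* If P u = u and p u = 1 for a column u and a row p, any
   solution G of (1 - P) G = 1 - u p gives Kemeny's constant as
   tr G - p G u.  The arc walk factors as P = H T, where T H is the vertex
   walk, so its constant exceeds that of the vertex walk by the number of arcs
   minus the number of vertices.  For the vertex walk, G is built from the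
   effective resistances R, and the constant is d R d^T / (2 s), where d is the
   vector of degrees and s its sum.  On a barbell with n vertices, R is explicit
   and the result is a sum of a function of n, of f n a and of f n b; among
   3 <= x <= n - 3, the function f n is largest at x = 3. *)

(** * Kemeny's constant of a matrix from a solution of a linear system *)

Lemma char_poly_similar {F : fieldType} {n : nat} {Q A T : 'M[F]_n} :
  Q \in unitmx -> Q *m A = T *m Q -> char_poly A = char_poly T.
Proof.
move=> Qu QA; pose q := map_mx polyC Q.
have qA : q *m char_poly_mx A = char_poly_mx T *m q.
  rewrite /char_poly_mx mulmxBr mulmxBl -!map_mxM QA.
  by rewrite mul_scalar_mx mul_mx_scalar.
have q_neq0 : \det q != 0.
  by rewrite /q det_map_mx polyC_eq0 -unitfE -unitmxE.
apply: (mulfI q_neq0).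
by rewrite /char_poly -det_mulmx qA det_mulmx mulrC.
Qed.

Lemma trig_mulmx_diag {R : pzRingType} {n : nat} {S T : 'M[R]_n} (i : 'I_n) :
  is_trig_mx S -> is_trig_mx T -> (S *m T) i i = S i i * T i i.
Proof.
move=> /is_trig_mxP trigS /is_trig_mxP trigT.
rewrite mxE (bigD1 i) //= big1 ?addr0 // => j j_neq_i.
case: (ltngtP i j) => [ij|ji|/val_inj ij]; last by rewrite ij eqxx in j_neq_i.
- by rewrite trigS ?mul0r.
- by rewrite trigT ?mulr0.
Qed.

Lemma char_poly_eigs {n : nat} (P : 'M[algC]_n) :
  char_poly P = \prod_(z <- eigs n P) ('X - z%:P).
Proof.
rewrite /eigs; case: closed_field_poly_normal => /= r.
by rewrite (monicP (char_poly_monic P)) scale1r.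
Qed.

(** [W] commutes with [A], so one unitary matrix makes both lower triangular. The diagonal of [A]
    then lists its eigenvalues, and the diagonal of [W] lists the inverses of one minus them. *)
Lemma sum_eigs_inv {n : nat} {A W : 'M[algC]_n} :
  (1%:M - A) *m W = 1%:M -> \sum_(z <- eigs n A) (1 - z)^-1 = \tr W.
Proof.
move=> AW; have WA := mulmx1C AW.
have comAW : A *m W = W *m A.
  move: (etrans AW (esym WA)); rewrite mulmxBl mulmxBr mul1mx mulmx1.
  by move/addrI/oppr_inj.
have [Q Qunitary /andP[trigA trigW]] := cotrigonalization2 comAW.
have Qu := unitarymx_unit Qunitary.
rewrite /similar_to !conjumx //= in trigA trigW.
set T := _ *m A *m _ in trigA; set S := _ *m W *m _ in trigW.
have TS : (1%:M - T) *m S = 1%:M.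
  rewrite /T /S -[1%:M in X in X *m _](mulmxV Qu) -{1}[Q](mulmx1 Q).
  rewrite -mulmxBl -mulmxBr !mulmxA mulmxKV // -(mulmxA Q) AW mulmx1.
  exact: mulmxV.
have eigsT : perm_eq (eigs n A) [seq T i i | i <- enum 'I_n].
  apply: prod_XsubC_eq; rewrite -char_poly_eigs big_map enumT.
  rewrite -[RHS]/(\prod_(i < n) ('X - (T i i)%:P)) -char_poly_trig //.
  by apply: (char_poly_similar Qu); rewrite /T mulmxKV.
rewrite (perm_big _ eigsT) /= big_map enumT.
have -> : \tr W = \tr S by rewrite /S mxtrace_mulC mulmxA mulVmx // mul1mx.
clearbody T S.
apply: eq_bigr => i _; have trigT1 : is_trig_mx (1%:M - T).
  apply/is_trig_mxP => j l jl; rewrite !mxE -val_eqE ltn_eqF //.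
  by rewrite (is_trig_mxP trigA) // subrr.
have := congr1 (fun M : 'M_n => M i i) TS.
rewrite trig_mulmx_diag // !mxE eqxx /= => TSi.
have nz : 1 - T i i != 0.
  by apply: contra_eq_neq TSi => ->; rewrite mul0r eq_sym oner_neq0.
by apply: (mulfI nz); rewrite divff.
Qed.

(* Both sides are determinants of the same block matrix
   [[1, -p], [u, xI - P]], right multiplied by [[x - 1, 0], [-u, I]]. *)
Lemma char_poly_deflate {R : comNzRingType} {n : nat} {P : 'M[R]_n}
    {u : 'cV[R]_n} {p : 'rV[R]_n} :
  P *m u = u -> p *m u = 1%:M ->
  char_poly (P - u *m p) * ('X - 1) = 'X * char_poly P.
Proof.
move=> Pu pu; pose U := map_mx polyC u; pose V := map_mx polyC p.
pose X := char_poly_mx P.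
have XU : X *m U = ('X - 1)%R *: U.
  by rewrite /X /U mulmxBl -map_mxM Pu mul_scalar_mx scalerBl scale1r.
have VU : V *m U = 1%:M by rewrite /V /U -map_mxM pu map_scalar_mx.
have XE : char_poly_mx (P - u *m p) = X + U *m V.
  by rewrite /char_poly_mx map_mxB map_mxM opprB addrA addrAC.
pose M := block_mx (1%:M : 'M_1) (- V) U X.
have detM : \det M = char_poly (P - u *m p).
  have -> : M = block_mx 1%:M 0 U 1%:M *m block_mx 1%:M (- V) 0 (X + U *m V).
    rewrite mulmx_block !mul1mx !mulmx1 !mul0mx mulmxN !addr0.
    by rewrite addrC addrK.
  by rewrite det_mulmx det_lblock det_ublock !det1 !mul1r /char_poly XE.
have MB : M *m block_mx ('X - 1)%:M 0 (- U) 1%:M = block_mx 'X%:M (- V) 0 X.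
  rewrite mulmx_block !mul1mx !mulmx1 !mulmx0 mulmxN mulNmx opprK add0r.
  rewrite VU mul_mx_scalar mulmxN XU subrr add0r.
  by rewrite -raddfD /= subrK.
have := congr1 determinant MB.
by rewrite det_mulmx detM det_lblock det_ublock !det_scalar1 det1 mulr1.
Qed.

(** Deflating by [u *m p] replaces one eigenvalue 1 of [P] by 0. Hence [1 - A] becomes invertible,
    and the trace of its inverse is Kemeny's constant plus the 1 contributed by the eigenvalue 0. *)
Lemma kemeny_trace {n : nat} {P G : 'M[algC]_n}
    {u : 'cV[algC]_n} {p : 'rV[algC]_n} :
  P *m u = u -> p *m u = 1%:M -> (1%:M - P) *m G = 1%:M - u *m p ->
  kemeny n P = \tr G - (p *m G *m u) 0 0.
Proof.
move=> Pu pu PG; pose A := P - u *m p.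
(* [1 - A] fixes [u], so the error [u p G - u p] left by [G] can be subtracted as it stands. *)
pose W := G + u *m p - u *m p *m G.
have AW : (1%:M - A) *m W = 1%:M.
  have upu : u *m p *m u = u by rewrite -mulmxA pu mulmx1.
  rewrite /A opprB addrA addrAC mulmxDl /W !mulmxDr !mulmxN PG.
  have Pu0 : (1%:M - P) *m u = 0 by rewrite mulmxBl mul1mx Pu subrr.
  rewrite !mulmxA Pu0 !mul0mx upu addr0 subr0.
  by rewrite [X in _ + X]addrAC subrr add0r subrK.
have eigsA : perm_eq (1 :: eigs n A) (0 :: eigs n P).
  apply: prod_XsubC_eq; rewrite !big_cons -!char_poly_eigs subr0.
  by rewrite -(char_poly_deflate Pu pu) mulrC.
have eigsP1 : 1 \in eigs n P.
  have : 1 \in 0 :: eigs n P by rewrite -(perm_mem eigsA) mem_head.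
  by rewrite inE oner_eq0.
have sumA := sum_eigs_inv AW.
have trW : \tr W = \tr G + 1 - (p *m G *m u) 0 0.
  rewrite /W mxtraceD mxtraceD raddfN /= (mxtrace_mulC u p) pu mxtrace1.
  by rewrite -mulmxA (mxtrace_mulC u) /mxtrace big_ord1.
(* Since the inverse of 0 is 0, the eigenvalue 1 adds nothing to either sum. *)
have : \sum_(z <- 1 :: eigs n A) (1 - z)^-1
     = \sum_(z <- 0 :: eigs n P) (1 - z)^-1 by exact: perm_big.
rewrite !big_cons subrr invr0 add0r subr0 invr1 sumA trW.
rewrite (perm_big _ (perm_to_rem eigsP1)) /= big_cons subrr invr0 add0r.
by move=> E; apply: (addrI 1); rewrite /kemeny -E addrA [1 + _]addrC.
Qed.

(** [1 + H G T] solves the system of [kemeny_trace] for [H T], with [H u] and [p T] in the roles of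
    [u] and [p]. Cyclicity of the trace moves its evaluation back to [T H G]. *)
Lemma kemeny_mulmx_swap {m n : nat} {H : 'M[algC]_(m, n)} {T : 'M[algC]_(n, m)}
    {G : 'M[algC]_n} {u : 'cV[algC]_n} {p : 'rV[algC]_n} :
  T *m H *m u = u -> p *m u = 1%:M ->
  (1%:M - T *m H) *m G = 1%:M - u *m p ->
  kemeny m (H *m T) = \tr G - (p *m G *m u) 0 0 + m%:R - n%:R.
Proof.
move=> THu pu THG.
have THGE : T *m H *m G = G - (1%:M - u *m p).
  by rewrite -THG mulmxBl mul1mx subKr.
have eqHTG : (1%:M - H *m T) *m (1%:M + H *m G *m T)
    = 1%:M - (H *m u) *m (p *m T).
  rewrite mulmxDr mulmx1 mulmxBl mul1mx.
  have -> : H *m T *m (H *m G *m T) = H *m (T *m H *m G) *m T.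
    by rewrite !mulmxA.
  rewrite -mulmxBl -mulmxBr THGE subKr mulmxBr mulmx1.
  by rewrite mulmxBl !mulmxA addrA subrK.
have Pu : H *m T *m (H *m u) = H *m u.
  by rewrite -[in RHS]THu !mulmxA.
have pe : p *m T *m (H *m u) = 1%:M.
  by rewrite -pu -[in RHS]THu !mulmxA.
rewrite (kemeny_trace Pu pe eqHTG) mxtraceD mxtrace1.
have -> : \tr (H *m G *m T) = \tr G - n%:R + 1.
  rewrite mxtrace_mulC mulmxA THGE !raddfB /= mxtrace1.
  by rewrite (mxtrace_mulC u) pu mxtrace1; ring.
have -> : p *m T *m (1%:M + H *m G *m T) *m (H *m u) = 1%:M + p *m G *m u.
  rewrite mulmxDr mulmx1 mulmxDl pe.
  have -> : p *m T *m (H *m G *m T) *m (H *m u)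
     = p *m (T *m H *m G) *m (T *m H *m u) by rewrite !mulmxA.
  rewrite THGE THu !mulmxBr mulmx1 !mulmxBl !mulmxA pu.
  by rewrite mul1mx pu subrr subr0.
rewrite mxE [in (1%:M : 'M_1) _ _]mxE /=; ring.
Qed.

(* The generalized inverse is G = (R d^T d / s - R D) / 2 with D = diag d:
   its trace is d R d^T / (2 s), and d G annihilates the constants. *)
Lemma kemeny_resistance {m n : nat} {H : 'M[algC]_(m, n)}
    {T : 'M[algC]_(n, m)} {R : 'M[algC]_n} {d : 'rV[algC]_n}
    {c : 'cV[algC]_n} {s : algC} :
  T *m H *m const_mx 1 = const_mx 1 :> 'cV_n ->
  (forall i, R i i = 0) -> d *m const_mx 1 = s%:M -> s != 0 ->
  (1%:M - T *m H) *m R *m diag_mx d = c *m d - 2%:M ->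
  kemeny m (H *m T) = (d *m R *m d^T) 0 0 / (2 * s) + m%:R - n%:R.
Proof.
move=> THu R0 du s0 hR; set u : 'cV_n := const_mx 1 in THu du *.
have Du : diag_mx d *m u = d^T.
  by apply/matrixP => i j; rewrite mul_diag_mx !mxE mulr1 ord1.
pose p := s^-1 *: d.
have pu : p *m u = 1%:M.
  by rewrite -scalemxAl du scale_scalar_mx mulVf.
pose G := (2 * s)^-1 *: (R *m d^T *m d) - 2^-1 *: (R *m diag_mx d).
have RdE : (1%:M - T *m H) *m (R *m d^T) = s *: c - 2 *: u.
  rewrite -Du !mulmxA hR mulmxBl -mulmxA du mul_mx_scalar.
  by rewrite mul_scalar_mx.
(* The column [c] cancels between the two terms of [G]. *)
have hG : (1%:M - T *m H) *m G = 1%:M - u *m p.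
  rewrite mulmxBr -!scalemxAr !mulmxA -(mulmxA _ R d^T) RdE hR.
  rewrite mulmxBl -!scalemxAl !scalerBr !scalerA scale_scalar_mx.
  have -> : (2 * s)^-1 * s = 2^-1 by field.
  have -> : (2 * s)^-1 * 2 = s^-1 by field.
  rewrite mulVf ?pnatr_eq0 // opprB.
  by rewrite addrC addrA subrK.
rewrite (kemeny_mulmx_swap THu pu hG); congr (_ + _ - _).
have -> : p *m G *m u = 0.
  rewrite /G mulmxBr mulmxBl -!scalemxAr -!scalemxAl -!mulmxA du Du.
  rewrite mul_mx_scalar -!scalemxAr !scalerA.
  have -> : (2 * s)^-1 / s * s = 2^-1 / s by field.
  exact: subrr.
rewrite [X in _ - X]mxE subr0 raddfB /= !linearZ /=.
have -> : \tr (R *m diag_mx d) = 0.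
  by rewrite /mxtrace big1 // => i _; rewrite mul_mx_diag mxE R0 mul0r.
rewrite mulr0 subr0 mxtrace_mulC mulmxA {1}/mxtrace big_ord1.
by rewrite mulrC.
Qed.

(** * From the arc walk to the vertex walk *)

Section ArcWalk.

Variables k a b : nat.
Local Notation N := (cb_n k a b).
Local Notation adj := (cb_adj k a b).
Local Notation deg := (cb_deg k a b).
Local Notation arc := (cb_arc k a b).

Lemma sum_arc (F : 'I_N -> 'I_N -> algC) :
  \sum_(x : arc) F (val x).1 (val x).2 = \sum_u \sum_(v | adj u v) F u v.
Proof.
rewrite pair_big_dep /=.
by rewrite (big_sub (fun x => adj x.1 x.2) (fun x => F x.1 x.2)).
Qed.

Lemma cb_degE v : (deg v)%:R = \sum_(w | adj v w) 1 :> algC.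
Proof.
rewrite /cb_deg -sum1_card natr_sum.
by apply: eq_bigl => w; rewrite inE.
Qed.

(** The hypothesis on [R] is an equation for the graph Laplacian. Dividing row [v] by [deg v] and
    multiplying column [j] by [deg j] turns it into the one of [kemeny_resistance]. The number of
    arcs is the degree sum [s]. *)
Lemma Ke_CB_resistance (R : 'M[algC]_N) (c : 'I_N -> algC) :
  (forall v, deg v != 0%N) -> (0 < N)%N -> (forall v, R v v = 0) ->
  (forall v j, \sum_(w | adj v w) (R v j - R w j) = c v - 2 * (v == j)%:R) ->
  let s := \sum_v (deg v)%:R in
  Ke_CB k a b
  = (\sum_v \sum_w (deg v)%:R * (deg w)%:R * R v w) / (2 * s) + s - N%:R.
Proof.
move=> deg0 N0 R0 hR s.
pose e (i : 'I_#|{: arc}|) := val (enum_val i).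
(* [H] sends an arc to its head, and [T] sends a vertex to a uniformly chosen outgoing arc. *)
pose H : 'M[algC]_(_, N) := \matrix_(i, v) ((e i).2 == v)%:R.
pose T : 'M[algC]_(N, _) :=
  \matrix_(v, i) ((deg v)%:R^-1 * (v == (e i).1)%:R).
have sum_e (F : 'I_N -> 'I_N -> algC) :
    \sum_i F (e i).1 (e i).2 = \sum_u \sum_(v | adj u v) F u v.
  rewrite -sum_arc; symmetry.
  apply: etrans (big_enum_val (fun x : arc => F (val x).1 (val x).2)).
  by apply: eq_bigl.
have HT : cb_arc_mx k a b = H *m T.
  apply/matrixP => i j; rewrite !mxE (bigD1 (e i).2) //= big1 ?addr0.
    rewrite !mxE eqxx mul1r /cb_arc_trans -/(e i) -/(e j).
    by case: eqP; rewrite ?mulr1 ?mulr0.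
  by move=> v ne; rewrite !mxE eq_sym (negPf ne) mul0r.
have TH : T *m H = \matrix_(v, w) ((deg v)%:R^-1 * (adj v w)%:R).
  apply/matrixP => v w; rewrite !mxE.
  under eq_bigr do rewrite !mxE -mulrA.
  rewrite -mulr_sumr (sum_e (fun x y => (v == x)%:R * (y == w)%:R)); congr (_ * _).
  rewrite (bigD1 v) //= [X in _ + X]big1 ?addr0; last first.
    by move=> x ne; rewrite big1 // => y _; rewrite eq_sym (negPf ne) mul0r.
  rewrite big_mkcond (bigD1 w) //= big1 ?addr0 ?eqxx ?mulr1.
    by case: ifP.
  by move=> y ne; rewrite (negPf ne) mulr0; case: ifP.
have deg0' v : (deg v)%:R != 0 :> algC by rewrite pnatr_eq0.
have s0 : s != 0.
  rewrite /s -natr_sum pnatr_eq0 sum_nat_eq0.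
  by apply/forallPn; exists (Ordinal N0); rewrite implyTb.
have card_arc : #|{: arc}|%:R = s.
  rewrite /s; under [RHS]eq_bigr do rewrite cb_degE.
  by rewrite -(sum_e (fun _ _ => 1)) sumr_const card_ord.
have mul_adj (F : 'I_N -> algC) v :
    \sum_w (deg v)%:R^-1 * (adj v w)%:R * F w = (deg v)%:R^-1 * \sum_(w | adj v w) F w.
  rewrite [in RHS]big_mkcond mulr_sumr; apply: eq_bigr => w _.
  by rewrite -mulrA; case: ifP; rewrite ?mul1r ?mul0r.
pose d : 'rV[algC]_N := \row_v (deg v)%:R.
rewrite /Ke_CB HT (@kemeny_resistance _ _ H T R d (\col_v ((deg v)%:R^-1 * c v)) s) //.
- rewrite card_arc; congr (_ / _ + _ - _).
  rewrite mxE exchange_big; apply: eq_bigr => w _.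
  by rewrite !mxE mulr_suml; apply: eq_bigr => v _; rewrite !mxE mulrAC.
- apply/matrixP => v j; rewrite !mxE TH.
  under eq_bigr do rewrite !mxE.
  by rewrite (mul_adj (fun=> 1)) -cb_degE mulVf.
- apply/matrixP => i j; rewrite !mxE !ord1 eqxx mulr1n.
  by apply: eq_bigr => v _; rewrite !mxE mulr1.
- apply/matrixP => v j; rewrite mul_mx_diag mulmxBl mul1mx.
  rewrite !mxE big_ord1 !mxE TH.
  under eq_bigr do rewrite mxE.
  have := hR v j; rewrite sumrB.
  have -> : \sum_(w | adj v w) R v j = (deg v)%:R * R v j.
    by rewrite cb_degE mulr_suml; apply: eq_bigr => w _; rewrite mul1r.
  rewrite (mul_adj (R^~ j)) => E.
  have -> : \sum_(w | adj v w) R w j = (deg v)%:R * R v j - (c v - 2 * (v == j)%:R).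
    by rewrite -E subKr.
  case: eqP => [->|_]; rewrite ?mulr1n ?mulr0n; field; exact: deg0'.
Qed.

End ArcWalk.

(** * Sums of truncated differences and of distances on a path *)

Lemma sum_subn (n p : nat) : (p <= n)%N ->
  (2 * \sum_(v < n) (p - v) = p * p.+1)%N.
Proof.
elim: n p => [|n IHn] [|p] //= pn; rewrite ?big_ord0 ?muln0 //.
  by rewrite big1 ?muln0 // => v _; rewrite sub0n.
rewrite big_ord_recl /= subn0 mulnDr.
by under eq_bigr do rewrite subSS; rewrite IHn //; lia.
Qed.

Lemma sum_subn_sq (n p : nat) : (p <= n)%N ->
  (6 * \sum_(v < n) (p - v) ^ 2 = p * p.+1 * (2 * p + 1))%N.
Proof.
elim: n p => [|n IHn] [|p] //= pn; rewrite ?big_ord0 ?muln0 //.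
  by rewrite big1 ?muln0 // => v _; rewrite sub0n.
rewrite big_ord_recl /= subn0 mulnDr.
by under eq_bigr do rewrite subSS; rewrite IHn //; lia.
Qed.

(** Reversing the vertex order lets sums to the right of a vertex reuse those to its left. *)
Lemma sum_subn_rev (n s : nat) (F : nat -> nat) :
  (\sum_(v < n) F (v - s) = \sum_(v < n) F (n.-1 - s - v))%N.
Proof.
rewrite (reindex_inj rev_ord_inj) /=; apply: eq_bigr => v _.
by congr (F _); lia.
Qed.

Definition distn (v w : nat) : nat := ((v - w) + (w - v))%N.

Lemma sum_distn (n p : nat) : (p < n)%N ->
  (2 * \sum_(v < n) distn v p = p * p.+1 + (n.-1 - p) * (n - p))%N.
Proof.
move=> pn; rewrite big_split /= mulnDr addnC sum_subn ?(ltnW pn) //.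
rewrite (sum_subn_rev n p id) sum_subn; last lia.
by congr (_ + _ * _)%N; lia.
Qed.

Lemma sum_sum_distn (n : nat) :
  (3 * (\sum_(v < n) \sum_(w < n) distn v w) + n = n ^ 3)%N.
Proof.
(* By symmetry the two truncated differences have the same double sum, and twice the inner sum of
   [v - w] is [v * v.+1]. *)
have -> : (\sum_(v < n) \sum_(w < n) distn v w = \sum_(v < n) v * v.+1)%N.
  under eq_bigr do rewrite big_split /=.
  rewrite big_split /= [X in (_ + X)%N]exchange_big /= addnn -mul2n big_distrr /=.
  by apply: eq_bigr => v _; rewrite sum_subn // ltnW.
elim: n => [|n IHn]; rewrite ?big_ord0 // big_ord_recr /=.
by move: IHn; rewrite !expnS !expn0; set S := bigop _ _ _; lia.
Qed.

(** Reduces the quadratic corrections in the resistances to first and second moments. *)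
Lemma sum_sum_sqrB {R : comPzRingType} (n : nat) (x : nat -> R) :
  \sum_(v < n) \sum_(w < n) (x v - x w) ^+ 2
  = 2 * n%:R * (\sum_(v < n) x v ^+ 2) - 2 * (\sum_(v < n) x v) ^+ 2.
Proof.
have E v : \sum_(w < n) (x v - x w) ^+ 2
    = n%:R * x v ^+ 2 + \sum_(w < n) x w ^+ 2 - 2 * x v * \sum_(w < n) x w.
  rewrite mulr_sumr -[n in n%:R]card_ord -sumr_const mulr_suml.
  by rewrite -big_split /= -sumrB; apply: eq_bigr => w _; ring.
under eq_bigr do rewrite E.
rewrite sumrB big_split /= sumr_const card_ord -mulr_sumr -mulr_suml -mulr_sumr.
ring.
Qed.

Lemma sum_ord_eq (n c : nat) (g : nat -> nat) :
  (\sum_(w < n) (w == c :> nat) * g w = (c < n) * g c)%N.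
Proof.
case: ltnP => [cn|nc]; last first.
  by rewrite big1 // => w _; rewrite ltn_eqF ?mul0n // (leq_trans (ltn_ord w)).
rewrite (bigD1 (Ordinal cn)) //= eqxx big1 ?addn0 // => w.
by rewrite -val_eqE /= => /negPf->.
Qed.

Lemma natr_sum_subn (n x : nat) : (x <= n)%N ->
  \sum_(v < n) (x - v)%:R = x%:R * (x%:R + 1) / 2 :> algC.
Proof.
move=> xn; rewrite natr1 -natrM -(sum_subn n) // natrM natr_sum.
by rewrite mulrAC divff ?mul1r // pnatr_eq0.
Qed.

Lemma natr_sum_subn_sq (n x : nat) : (x <= n)%N ->
  \sum_(v < n) (x - v)%:R ^+ 2 = x%:R * (x%:R + 1) * (2 * x%:R + 1) / 6 :> algC.
Proof.
move=> xn; have := congr1 (fun m => m%:R : algC) (sum_subn_sq n x xn).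
rewrite /= !natrM natrD natrM -(natr1 x) natr_sum => <-.
rewrite mulrAC divff ?mul1r ?pnatr_eq0 //.
by apply: eq_bigr => v _; rewrite natrX.
Qed.

Lemma natr_sum_distn (n x : nat) : (x < n)%N ->
  \sum_(v < n) (distn v x)%:R
  = (x%:R * (x%:R + 1) + (n%:R - x%:R - 1) * (n%:R - x%:R)) / 2 :> algC.
Proof.
move=> xn; have := congr1 (fun m => m%:R : algC) (sum_distn n x xn).
rewrite /= natrM natr_sum natrD !natrM -(natr1 x).
have -> : (n.-1 - x)%:R = n%:R - x%:R - 1 :> algC.
  apply: (addIr 1); rewrite subrK natr1 -natrB ?(ltnW xn) //.
  by congr _%:R; lia.
rewrite natrB ?(ltnW xn) // => <-; rewrite mulrAC divff ?mul1r //.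
by rewrite pnatr_eq0.
Qed.

(** The terms of [d R d^T] in which a cycle of length [x] enters. The first two come from the sum of
    all resistances, the last from the resistance between the junctions, the others from resistances
    to a junction. This is the [f] of the overview, up to the factor [1 / (4 (n + 1))]. *)
Definition cycle_term (n x : algC) : algC :=
  - 4 * (x - 1) * (2 * x - 1) * n / 3 + 2 * x * (x - 1) ^+ 2 + 2 * x * (x - 1)
  + 2 * (n - x) * (n - x + 1) - 4 * (x - 1) * (2 * x - 1) / 3 - 2 * x.

(** * Degrees, Laplacian and resistances of a barbell with junctions [p] and [s] *)

Section Barbell.

Variables k a b : nat.
Hypotheses (a3 : (3 <= a)%N) (b3 : (3 <= b)%N) (k2 : (2 <= k)%N).
Local Notation N := (cb_n k a b).
Local Notation adj := (cb_adj k a b).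
Local Notation deg := (cb_deg k a b).
Local Notation p := a.-1.
Local Notation s := (a + k - 2)%N.

Lemma cb_nE : N = N.-1.+1.
Proof. by rewrite /cb_n; lia. Qed.

Lemma cb_ltS_n (v : nat) : (v.+1 < N)%N = (v < N.-1)%N.
Proof. by rewrite [in LHS]cb_nE. Qed.

Lemma cb_ord_le (v : 'I_N) : (v <= N.-1)%N.
Proof. by rewrite -ltnS -cb_nE. Qed.

Lemma cb_last : N.-1 = (a + b + k - 3)%N.
Proof. by rewrite /cb_n; lia. Qed.

(** The case analyses on adjacency below generalize [p], [s] and [N.-1], keeping these inequalities.
    They say that neither closing edge is a path edge and that the junctions differ. *)
Lemma cb_order : [/\ (2 <= p)%N, (p < s)%N & (s.+2 <= N.-1)%N].
Proof. by rewrite /cb_n; split; lia. Qed.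

Lemma sum_cb_adj (g : nat -> nat) (v : 'I_N) :
  (\sum_(w | adj v w) g w =
   (0 < v) * g v.-1 + (v.+1 < N) * g v.+1 + (v == 0 :> nat) * g p
   + (v == p :> nat) * g 0 + (v == s :> nat) * g N.-1
   + (v == N.-1 :> nat) * g s)%N.
Proof.
have adjE (w : 'I_N) : nat_of_bool (adj v w) =
    ((0 < v) * (w == v.-1 :> nat) + (w == v.+1 :> nat)
     + (v == 0 :> nat) * (w == p :> nat) + (v == p :> nat) * (w == 0 :> nat)
     + (v == s :> nat) * (w == N.-1 :> nat)
     + (v == N.-1 :> nat) * (w == s :> nat))%N.
  rewrite /cb_adj /cb_edge0 !ltn_ord !andbT lt0n -cb_last.
  move: cb_order (cb_ord_le v) (cb_ord_le w).
  move: (nat_of_ord v) (nat_of_ord w) p s N.-1 => {}v {}w x y z.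
  move=> [x2 xy yz] v_le w_le.
  do ![case: eqP => ? /=; try (exfalso; lia)]; lia.
rewrite big_mkcond /=.
transitivity (\sum_(w < N) adj v w * g w)%N.
  by apply: eq_bigr => w _; case: ifP; rewrite ?mul1n ?mul0n.
under eq_bigr do rewrite adjE !mulnDl -!mulnA.
rewrite !big_split /= -!big_distrr /= !sum_ord_eq.
have [-> ->] : (p < N)%N = true /\ (s < N)%N = true by rewrite /cb_n; lia.
have [-> ->] : (0 < N)%N = true /\ (N.-1 < N)%N = true by rewrite /cb_n; lia.
have -> : (v.-1 < N)%N = true by have := ltn_ord v; lia.
by rewrite !mul1n.
Qed.

Lemma cb_deg_val (v : 'I_N) : deg v = (2 + (v == p :> nat) + (v == s :> nat))%N.
Proof.
rewrite /cb_deg -sum1_card.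
under eq_bigl do rewrite inE.
rewrite (sum_cb_adj (fun=> 1%N)) !muln1.
move: cb_order (cb_ord_le v); rewrite cb_ltS_n lt0n.
move: (nat_of_ord v) p s N.-1 => {}v x y z [x2 xy yz] v_le.
rewrite ltn_neqAle v_le andbT.
do ![case: eqP => ? /=; try (exfalso; lia)]; lia.
Qed.


(** The function [p - w] is linear on the left cycle and zero beyond, so its Laplacian lives on the
    closing edge: it is [a] at 0 and [- a] at [p]. Terms are placed so that no subtraction truncates
    wrongly. *)
Lemma sum_adj_subl (v : 'I_N) :
  (\sum_(w | adj v w) (p - w) + (v == 0 :> nat) * p.+1
   = deg v * (p - v) + (v == p :> nat) * p.+1)%N.
Proof.
rewrite (sum_cb_adj (fun w => p - w)%N) cb_deg_val.
move: cb_order (cb_ord_le v); rewrite cb_ltS_n lt0n.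
move: (nat_of_ord v) p s N.-1 => {}v x y z [x2 xy yz] v_le.
rewrite ltn_neqAle v_le andbT.
do ![case: eqP => ? /=; try (exfalso; lia)]; lia.
Qed.

Lemma sum_adj_subr (v : 'I_N) :
  (\sum_(w | adj v w) (w - s) + (v == N.-1 :> nat) * (N.-1 - s).+1
   = deg v * (v - s) + (v == s :> nat) * (N.-1 - s).+1)%N.
Proof.
rewrite (sum_cb_adj (fun w => w - s)%N) cb_deg_val.
move: cb_order (cb_ord_le v); rewrite cb_ltS_n lt0n.
move: (nat_of_ord v) p s N.-1 => {}v x y z [x2 xy yz] v_le.
rewrite ltn_neqAle v_le andbT.
do ![case: eqP => ? /=; try (exfalso; lia)]; lia.
Qed.

(** Along the path alone, the distance to [j] has a kink only at [j], which gives the term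
    [2 * (v == j)]. The other terms account for the two closing edges and the ends of the path. *)
Lemma sum_adj_distn (v j : 'I_N) :
  (\sum_(w | adj v w) distn w j + (v == 0 :> nat) * p.+1
     + (v == p :> nat) * (2 * (p - j))
     + (v == N.-1 :> nat) * (N.-1 - s).+1 + (v == s :> nat) * (2 * (j - s))
   = deg v * distn v j + (v == p :> nat) * p + (v == 0 :> nat) * (2 * (p - j))
     + (v == s :> nat) * (N.-1 - s) + (v == N.-1 :> nat) * (2 * (j - s))
     + 2 * (v == j))%N.
Proof.
rewrite (sum_cb_adj (distn^~ j)) cb_deg_val /distn -val_eqE /=.
move: cb_order (cb_ord_le v) (cb_ord_le j); rewrite cb_ltS_n lt0n.
move: (nat_of_ord v) (nat_of_ord j) p s N.-1 => {}v {}j x y z.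
move=> [x2 xy yz] v_le j_le.
rewrite ltn_neqAle v_le andbT.
do ![case: eqP => ? /=; try (exfalso; lia)]; lia.
Qed.

(* Effective resistances: the path 0, ..., N - 1 contributes |v - w|, and each
   of the two closing edges subtracts the square of the distance travelled
   inside its cycle, divided by the length of the cycle. *)
Definition cb_res (v w : nat) : algC :=
  (distn v w)%:R - ((p - v)%:R - (p - w)%:R) ^+ 2 / a%:R
  - ((v - s)%:R - (w - s)%:R) ^+ 2 / b%:R.

Lemma cb_res_sym v w : cb_res v w = cb_res w v.
Proof.
rewrite /cb_res /distn addnC -(sqrrN ((p - v)%:R - _)).
by rewrite -(sqrrN ((v - s)%:R - _)) !opprB.
Qed.

Lemma cb_res0 v : cb_res v v = 0.
Proof. by rewrite /cb_res /distn !subnn !subrr expr0n /= !mul0r !subr0. Qed.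

Lemma sum_adj_sqrB (x : nat -> nat) (v j : 'I_N) :
  \sum_(w | adj v w) ((x w)%:R - (x j)%:R) ^+ 2
  = \sum_(w | adj v w) (x w)%:R ^+ 2
    - 2 * (x j)%:R * (\sum_(w | adj v w) x w)%N%:R
    + (deg v)%:R * (x j)%:R ^+ 2 :> algC.
Proof.
rewrite cb_degE mulr_suml natr_sum mulr_sumr -sumrB -big_split /=.
by apply: eq_bigr => w _; ring.
Qed.

(** The value of the Laplacian of the resistances away from [v = j]; what matters is that [j] does
    not occur in it. *)
Let c (v : 'I_N) : algC :=
  (v == 0 :> nat)%:R * a%:R - (v == p :> nat)%:R * p%:R
  + (v == N.-1 :> nat)%:R * b%:R - (v == s :> nat)%:R * (N.-1 - s)%:R
  - ((deg v)%:R * (p - v)%:R ^+ 2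
     - \sum_(w | adj v w) (p - w)%:R ^+ 2) / a%:R
  - ((deg v)%:R * (v - s)%:R ^+ 2
     - \sum_(w | adj v w) (w - s)%:R ^+ 2) / b%:R.

(** The terms [2 * (p - j)] and [2 * (j - s)] that the closing edges cause in [sum_adj_distn] cancel
    against the cross terms of the two squares in [cb_res]. *)
Lemma cb_laplace_res (v j : 'I_N) :
  \sum_(w | adj v w) (cb_res v j - cb_res w j) = c v - 2 * (v == j)%:R.
Proof.
rewrite sumrB.
have -> : \sum_(w | adj v w) cb_res v j = (deg v)%:R * cb_res v j.
  by rewrite cb_degE mulr_suml; apply: eq_bigr => w _; rewrite mul1r.
rewrite {2}/cb_res !sumrB -!mulr_suml -natr_sum.
rewrite (sum_adj_sqrB (fun w => p - w)%N) (sum_adj_sqrB (fun w => w - s)%N).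
have aE : p.+1 = a by lia.
have bE : (N.-1 - s).+1 = b by rewrite /cb_n; lia.
have := congr1 (fun n => n%:R : algC) (sum_adj_subl v).
rewrite /= aE !natrD !natrM => /(canRL (addrK _)) ->.
have := congr1 (fun n => n%:R : algC) (sum_adj_subr v).
rewrite /= bE !natrD !natrM => /(canRL (addrK _)) ->.
have := congr1 (fun n => n%:R : algC) (sum_adj_distn v j).
rewrite /= aE bE !natrD !natrM => /(canRL (addrK _))/(canRL (addrK _)).
move=> /(canRL (addrK _))/(canRL (addrK _)) ->.
rewrite /c /cb_res; field.
by rewrite !pnatr_eq0; lia.
Qed.

Lemma sum_deg_mul (F : nat -> algC) :
  \sum_(v < N) (deg v)%:R * F v = 2 * (\sum_(v < N) F v) + F p + F s.
Proof.
have sumE x : (x < N)%N -> \sum_(v < N) (v == x :> nat)%:R * F v = F x.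
  move=> xN; rewrite (bigD1 (Ordinal xN)) //= eqxx mul1r big1 ?addr0 // => v.
  by rewrite -val_eqE /= => /negPf->; rewrite mul0r.
have [pN sN] : (p < N)%N /\ (s < N)%N by rewrite /cb_n; lia.
rewrite -[F p](sumE p pN) -[F s](sumE s sN) mulr_sumr -!big_split /=.
by apply: eq_bigr => v _; rewrite cb_deg_val // !natrD !mulrDl.
Qed.

Lemma cb_params : [/\ (p <= N)%N, (N.-1 - s <= N)%N, p%:R = a%:R - 1 :> algC
  & (N.-1 - s)%:R = b%:R - 1 :> algC].
Proof.
split; rewrite ?/cb_n; [lia|lia|..].
  by rewrite -subn1 natrB //; lia.
by apply: (addIr 1); rewrite subrK natr1; congr _%:R; lia.
Qed.

Lemma sum_left : \sum_(v < N) (p - v)%:R = a%:R * (a%:R - 1) / 2 :> algC.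
Proof. by have [pN _ pE _] := cb_params; rewrite natr_sum_subn // pE; field. Qed.

Lemma sum_left_sq :
  \sum_(v < N) (p - v)%:R ^+ 2
  = a%:R * (a%:R - 1) * (2 * a%:R - 1) / 6 :> algC.
Proof. by have [pN _ pE _] := cb_params; rewrite natr_sum_subn_sq // pE; field. Qed.

Lemma sum_right : \sum_(v < N) (v - s)%:R = b%:R * (b%:R - 1) / 2 :> algC.
Proof.
have [_ qN _ qE] := cb_params.
by rewrite -natr_sum (sum_subn_rev N s id) natr_sum natr_sum_subn // qE; field.
Qed.

Lemma sum_right_sq :
  \sum_(v < N) (v - s)%:R ^+ 2
  = b%:R * (b%:R - 1) * (2 * b%:R - 1) / 6 :> algC.
Proof.
have [_ qN _ qE] := cb_params.
under eq_bigr do rewrite -natrX.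
rewrite -natr_sum (sum_subn_rev N s (expn^~ 2)) natr_sum.
under eq_bigr do rewrite natrX.
by rewrite natr_sum_subn_sq // qE; field.
Qed.

Lemma sum_cb_res : \sum_(v < N) \sum_(w < N) cb_res v w =
  (N%:R ^+ 3 - N%:R) / 3
  - (a%:R - 1) * (N%:R * (2 * a%:R - 1) / 3 - a%:R * (a%:R - 1) / 2)
  - (b%:R - 1) * (N%:R * (2 * b%:R - 1) / 3 - b%:R * (b%:R - 1) / 2).
Proof.
under eq_bigr do rewrite !sumrB -!mulr_suml -natr_sum.
rewrite !sumrB -!mulr_suml -natr_sum.
rewrite (sum_sum_sqrB N (fun v => (p - v)%:R)).
rewrite (sum_sum_sqrB N (fun v => (v - s)%:R)).
rewrite sum_left sum_left_sq sum_right sum_right_sq.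
have -> : (\sum_(v < N) \sum_(w < N) distn v w)%:R = (N%:R ^+ 3 - N%:R) / 3 :> algC.
  rewrite -natrX -(sum_sum_distn N) natrD natrM addrK mulrAC divff ?mul1r //.
  by rewrite pnatr_eq0.
by field; rewrite !pnatr_eq0; lia.
Qed.

Lemma sum_cb_resl : \sum_(v < N) cb_res v p =
  (a%:R * (a%:R - 1) + (N%:R - a%:R) * (N%:R - a%:R + 1)) / 2
  - (a%:R - 1) * (2 * a%:R - 1) / 6 - (b%:R - 1) * (2 * b%:R - 1) / 6.
Proof.
have [_ _ pE _] := cb_params.
have p0 : (p - s = 0)%N by lia.
rewrite !sumrB -!mulr_suml subnn p0 natr_sum_distn; last by rewrite /cb_n; lia.
under eq_bigr do rewrite subr0.
under [in X in _ - X]eq_bigr do rewrite subr0.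
rewrite sum_left_sq sum_right_sq pE.
by field; rewrite !pnatr_eq0; lia.
Qed.

Lemma sum_cb_resr : \sum_(v < N) cb_res v s =
  (b%:R * (b%:R - 1) + (N%:R - b%:R) * (N%:R - b%:R + 1)) / 2
  - (a%:R - 1) * (2 * a%:R - 1) / 6 - (b%:R - 1) * (2 * b%:R - 1) / 6.
Proof.
have p0 : (p - s = 0)%N by lia.
have sE : s%:R = N%:R - b%:R :> algC.
  by rewrite -natrB; [congr _%:R|]; rewrite /cb_n; lia.
rewrite !sumrB -!mulr_suml subnn p0 natr_sum_distn; last by rewrite /cb_n; lia.
under eq_bigr do rewrite subr0.
under [in X in _ - X]eq_bigr do rewrite subr0.
rewrite sum_left_sq sum_right_sq sE.
by field; rewrite !pnatr_eq0; lia.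
Qed.

(** Each degree is 2 plus the indicators of the two junctions, so [d R d^T] splits into the full sum
    of resistances, the sums to each junction, and the resistance between the junctions. *)
Lemma Ke_CB_val : Ke_CB k a b =
  (4 * (N%:R ^+ 3 - N%:R) / 3 + cycle_term N%:R a%:R + cycle_term N%:R b%:R
   + 2 * (N%:R + 1)) / (4 * (N%:R + 1)) + N%:R + 2.
Proof.
have N0 : (0 < N)%N by rewrite /cb_n; lia.
rewrite (Ke_CB_resistance k a b (\matrix_(v, w) cb_res v w) c) //; first last.
- by move=> v j; under eq_bigr do rewrite !mxE; exact: cb_laplace_res.
- by move=> v; rewrite mxE cb_res0.
- by move=> v; rewrite cb_deg_val.
have -> : \sum_(v < N) (deg v)%:R = 2 * (N%:R + 1) :> algC.
  under eq_bigr do rewrite -[_%:R]mulr1.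
  by rewrite (sum_deg_mul (fun=> 1)) sumr_const card_ord; ring.
have -> : \sum_(v < N) \sum_(w < N)
    (deg v)%:R * (deg w)%:R * (\matrix_(v, w) cb_res v w : 'M_N) v w
    = 4 * (\sum_(v < N) \sum_(w < N) cb_res v w)
      + 4 * (\sum_(v < N) cb_res v p) + 4 * (\sum_(v < N) cb_res v s)
      + 2 * cb_res p s.
  under eq_bigr => v _.
    under eq_bigr => w _ do rewrite mxE -mulrA.
    rewrite -mulr_sumr (sum_deg_mul (cb_res v)); over.
  rewrite (sum_deg_mul (fun v => 2 * (\sum_(w < N) cb_res v w) + cb_res v p + cb_res v s)).
  rewrite 2!big_split /= -mulr_sumr !cb_res0 (cb_res_sym s p).
  have sym_sum x : \sum_(w < N) cb_res x w = \sum_(w < N) cb_res w x.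
    by apply: eq_bigr => w _; exact: cb_res_sym.
  rewrite (sym_sum p) (sym_sum s); ring.
(* The junctions are joined by a path of bridges, so their resistance is its length [k - 1]. *)
have -> : cb_res p s = N%:R + 1 - a%:R - b%:R.
  rewrite /cb_res !subnn.
  have -> : (p - s)%N = 0%N by lia.
  rewrite subrr expr0n /= !mul0r !subr0.
  have -> : N%:R = a%:R + b%:R + (distn p s)%:R - 1 :> algC.
    apply: (addIr 1); rewrite subrK natr1 -!natrD.
    by congr _%:R; rewrite /distn /cb_n; lia.
  ring.
rewrite sum_cb_res sum_cb_resl sum_cb_resr /cycle_term; field.
by rewrite natr1 pnatr_eq0.
Qed.

End Barbell.

(* With a = u + 3 and n = a + 3 + w, the difference of the two terms is a
   polynomial in u and w with nonnegative coefficients. *)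
Lemma cycle_term_le (n a : nat) : (3 <= a)%N -> (a + 3 <= n)%N ->
  cycle_term n%:R a%:R <= cycle_term n%:R 3.
Proof.
move=> a3 an; pose u := (a - 3)%N; pose w := (n - a - 3)%N.
rewrite -subr_ge0; have -> : a = (u + 3)%N by lia.
have -> : n = (u + 3 + 3 + w)%N by lia.
have -> : cycle_term (u + 3 + 3 + w)%:R 3 - cycle_term (u + 3 + 3 + w)%:R (u + 3)%:R
  = (174 * u + 48 * u * w + 50 * u ^ 2 + 8 * u ^ 2 * w + 2 * u ^ 3)%:R / 3.
  by rewrite !(natrD, natrM, natrX) /cycle_term; field.
by rewrite divr_ge0 ?ler0n.
Qed.

Theorem theorem5p6 (n : nat) : (6 <= n)%N ->
  (forall k a b : nat, (3 <= a)%N -> (3 <= b)%N -> (2 <= k)%N ->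
     cb_n k a b = n -> Ke_CB k a b <= Ke_CB (n - 4) 3 3) /\
  Ke_CB (n - 4) 3 3 =
    (2 * n%:R ^+ 3 + 12 * n%:R ^+ 2 - 51 * n%:R + 101) / (6 * (n%:R + 1)).
Proof.
move=> n6.
have n33 : cb_n (n - 4) 3 3 = n by rewrite /cb_n; lia.
have K33 := Ke_CB_val (n - 4) 3 3 isT isT ltac:(lia).
rewrite n33 in K33; split=> [k a b a3 b3 k2 nE|].
  (* For fixed [n] only the two cycle terms vary, so each is bounded separately. Since the other
     cycle has length at least 3 and [k] is at least 2, each cycle length is at most [n - 3]. *)
  rewrite K33 Ke_CB_val // nE !lerD2r ler_pM2r; last first.
    by rewrite invr_gt0 mulr_gt0 // natr1 ltr0n.
  by rewrite lerD2r lerD // ?lerD2l; apply: cycle_term_le => //; rewrite -nE /cb_n; lia.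
rewrite K33 /cycle_term; field.
by rewrite natr1 pnatr_eq0.
Qed.
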